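(* Let $q$ be a prime power with $q\equiv3\pmod4$, $G=\mathrm{SL}_2(\mathbb F_q)$, and $S$ the union of the conjugacy classes in $G$ of $\begin{pmatrix}1&0\\1&1\end{pmatrix}$ and $\begin{pmatrix}1&0\\-1&1\end{pmatrix}$. Let $\sigma_q$ be the automorphism of $G$ induced by conjugation by either of the matrices $\begin{pmatrix}0&1\\1&0\end{pmatrix}$, $\begin{pmatrix}0&1\\-1&0\end{pmatrix}$ in $\mathrm{GL}_2(\mathbb F_q)$. Then the graphs $C_\Sigma(G,S)$, $C(G,S)^{\sigma_q}$ and $C_\Sigma(G,S)^{\sigma_q}$ are Ramanujan graphs.
   Context: For a group $G$, subset $S$ and automorphism $\sigma$: $C_\Sigma(G,S)$ has vertex set $G$ and an edge from $x$ to $x^{-1}s$ for each $s\in S$; $C(G,S)^\sigma$ has an edge from $x$ to $\sigma(xs)$; $C_\Sigma(G,S)^\sigma$ has an edge from $x$ to $\sigma(x^{-1}s)$. A $k$-regular undirected graph is Ramanujan if every eigenvalue $\lambda$ of its adjacency matrix with $|\lambda|\ne k$ satisfies $|\lambda|\le2\sqrt{k-1}$. *)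

(* Defs.v *)
From HB Require Import structures.
From mathcomp Require Import all_boot all_order all_algebra all_field.
Set Implicit Arguments. Unset Strict Implicit. Unset Printing Implicit Defensive.
Import Order.TTheory GRing.Theory Num.Theory.
Local Open Scope ring_scope.

Section Defs.
Variable F : finFieldType.

Definition mx2 (a b c d : F) : 'M[F]_2 :=
  \matrix_(i < 2, j < 2)
    if (i == 0 :> nat) then (if (j == 0 :> nat) then a else b)
    else (if (j == 0 :> nat) then c else d).

Definition SL2 : {set 'M[F]_2} := [set A : 'M[F]_2 | \det A == 1].

Definition conjclass_SL2 (u : 'M[F]_2) : {set 'M[F]_2} :=
  [set g *m u *m invmx g | g in SL2].

Definition S_gen : {set 'M[F]_2} :=
  conjclass_SL2 (mx2 1 0 1 1) :|: conjclass_SL2 (mx2 1 0 (-1) 1).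

Definition conjby (w x : 'M[F]_2) : 'M[F]_2 := w *m x *m invmx w.

Definition adjmx (S : {set 'M[F]_2}) (f : 'M[F]_2 -> 'M[F]_2 -> 'M[F]_2)
  : 'M[algC]_#|SL2| :=
  \matrix_(i, j) (#|[set s in S | f (enum_val i) s == enum_val j]|)%:R.

Definition edge_Sigma (x s : 'M[F]_2) := invmx x *m s.
Definition edge_twist (w x s : 'M[F]_2) := conjby w (x *m s).
Definition edge_Sigma_twist (w x s : 'M[F]_2) :=
  conjby w (invmx x *m s).
End Defs.

Definition Ramanujan (n : nat) (A : 'M[algC]_n) : Prop :=
  exists k : nat,
    [/\ A^T = A,
        (forall i, \sum_j A i j = k%:R) &
        forall l : algC, eigenvalue A l -> `|l| != k%:R ->
          `|l| <= 2 * sqrtC (k.-1)%:R].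

(* Main.v *)
(** The conjugacy classes are stable under inversion and under the twisting
    automorphism, so each of the three adjacency operators has the same square
    as the operator [T f x = \sum_(s in S) f (x s)] of the Cayley graph.  For
    [q = 3 mod 4] the set [S] consists of all [1 + n] with [n] nonzero
    nilpotent, so [k = #|S| = q^2 - 1].  In the group algebra, let [St] be the
    class function [g |-> #{fixed points of g on the projective line} - 1]
    (the Steinberg character).  Counting nilpotents [n] with prescribed
    [tr (g n)] gives [S^2 + 2 S - k = q \sum_g g - St] and [S St = 0], hence
    [T (T^2 + 2 T - k) = 0] on functions of sum zero.  For an eigenvalue [l]
    of one of the graphs with [l^2 <> k^2], this forces [l = 0] or
    [(l^2 - k)^2 = 4 l^2], i.e. [l \in {+-1 +- q}], and
    [q + 1 <= 2 sqrt (k - 1)] because [q >= 3]. *)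

Require Import Defs.
From HB Require Import structures.
From mathcomp Require Import all_boot all_order all_algebra all_field.
From mathcomp Require Import ring zify.
Set Implicit Arguments. Unset Strict Implicit. Unset Printing Implicit Defensive.
Import Order.TTheory GRing.Theory Num.Theory.
Local Open Scope ring_scope.

(** * Two-by-two matrices, and S described by nilpotents *)

Section TwoByTwo.
Variable F : finFieldType.
Implicit Types (a b c d : F) (A B : 'M[F]_2).

Lemma mx2_inj a b c d a' b' c' d' :
  mx2 a b c d = mx2 a' b' c' d' -> [/\ a = a', b = b', c = c' & d = d'].
Proof.
move=> E; split.
- by have := congr1 (fun M : 'M_2 => M 0 0) E; rewrite !mxE.
- by have := congr1 (fun M : 'M_2 => M 0 1) E; rewrite !mxE.
- by have := congr1 (fun M : 'M_2 => M 1 0) E; rewrite !mxE.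
- by have := congr1 (fun M : 'M_2 => M 1 1) E; rewrite !mxE.
Qed.

Lemma mx2_eta A : A = mx2 (A 0 0) (A 0 1) (A 1 0) (A 1 1).
Proof.
by apply/matrixP=> -[[|[|//]] ?] [[|[|//]] ?]; rewrite !mxE /=; congr (A _ _); apply/val_inj.
Qed.

Lemma mulmx2 a b c d a' b' c' d' :
  mx2 a b c d *m mx2 a' b' c' d' =
  mx2 (a * a' + b * c') (a * b' + b * d') (c * a' + d * c') (c * b' + d * d').
Proof.
by apply/matrixP=> -[[|[|//]] ?] [[|[|//]] ?]; rewrite !mxE 2!big_ord_recl big_ord0 !mxE addr0.
Qed.

Lemma addmx2 a b c d a' b' c' d' :
  mx2 a b c d + mx2 a' b' c' d' = mx2 (a + a') (b + b') (c + c') (d + d').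
Proof. by apply/matrixP=> -[[|[|//]] ?] [[|[|//]] ?]; rewrite !mxE. Qed.

Lemma oppmx2 a b c d : - mx2 a b c d = mx2 (- a) (- b) (- c) (- d).
Proof. by apply/matrixP=> -[[|[|//]] ?] [[|[|//]] ?]; rewrite !mxE. Qed.

Lemma scalar_mx2 a : a%:M = mx2 a 0 0 a.
Proof. by apply/matrixP=> -[[|[|//]] ?] [[|[|//]] ?]; rewrite !mxE. Qed.

Lemma mx2_0 : 0 = mx2 0 0 0 0 :> 'M[F]_2.
Proof. by apply/matrixP=> -[[|[|//]] ?] [[|[|//]] ?]; rewrite !mxE. Qed.

Lemma mxtrace_mx2 a b c d : \tr (mx2 a b c d) = a + d.
Proof. by rewrite /mxtrace 2!big_ord_recl big_ord0 !mxE addr0. Qed.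

Lemma det_mx2 a b c d : \det (mx2 a b c d) = a * d - b * c.
Proof.
rewrite (expand_det_row _ 0) 2!big_ord_recl big_ord0 /cofactor !det_mx11 !mxE /=.
by rewrite expr0 expr1; ring.
Qed.

Lemma mx2_eq0 a b c d :
  (mx2 a b c d == 0) = [&& a == 0, b == 0, c == 0 & d == 0].
Proof.
rewrite mx2_0; apply/eqP/and4P => [/mx2_inj[-> -> -> ->] | [/eqP-> /eqP-> /eqP-> /eqP->]//].
by rewrite eqxx.
Qed.

Lemma SL2E A : (A \in SL2 F) = (\det A == 1).
Proof. by rewrite inE. Qed.

Lemma SL2_unit A : A \in SL2 F -> A \in unitmx.
Proof. by rewrite SL2E unitmxE => /eqP->; apply: unitr1. Qed.

Lemma SL2M A B : A \in SL2 F -> B \in SL2 F -> A *m B \in SL2 F.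
Proof. by rewrite !SL2E det_mulmx => /eqP-> /eqP->; rewrite mulr1. Qed.

Lemma SL2V A : A \in SL2 F -> invmx A \in SL2 F.
Proof. by rewrite !SL2E det_inv => /eqP->; rewrite invr1. Qed.

Lemma SL2_1 : 1%:M \in SL2 F.
Proof. by rewrite SL2E det1. Qed.

(** Cayley-Hamilton in determinant 1: A^2 - tr(A) A + 1 = 0. *)
Lemma invmx_SL2 A : A \in SL2 F -> invmx A = (\tr A)%:M - A.
Proof.
move=> AS; apply: (can_inj (mulKmx (SL2_unit AS))).
rewrite mulmxV ?SL2_unit //; move: AS; rewrite SL2E (mx2_eta A).
move: (A 0 0) (A 0 1) (A 1 0) (A 1 1) => a b c d.
rewrite det_mx2 mxtrace_mx2 !scalar_mx2 oppmx2 addmx2 mulmx2 => /eqP E.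
by congr mx2; rewrite -?E; ring.
Qed.

Lemma conj_mxtrace g A : g \in unitmx -> \tr (g *m A *m invmx g) = \tr A.
Proof. by move=> ug; rewrite mxtrace_mulC mulmxA mulVmx // mul1mx. Qed.

Lemma conj_mxdet g A : g \in unitmx -> \det (g *m A *m invmx g) = \det A.
Proof.
move=> ug; rewrite !det_mulmx mulrAC -det_mulmx mulmxV //.
by rewrite det1 mul1r.
Qed.

(** By Cayley-Hamilton these are the nonzero nilpotents. *)
Definition nilmx : {set 'M[F]_2} :=
  [set n : 'M[F]_2 | [&& \tr n == 0, \det n == 0 & n != 0]].

Lemma nilmxP n : reflect (exists a b c, [/\ n = mx2 a b c (- a), a ^+ 2 + b * c = 0
   & (b != 0) || (c != 0)]) (n \in nilmx).
Proof.
rewrite inE {2 3 4}(mx2_eta n) mxtrace_mx2 det_mx2 mx2_eq0.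
apply: (iffP and3P) => [[]|[a [b [c [-> E N]]]]].
  rewrite addrC addr_eq0 => /eqP E /eqP D N.
  exists (n 0 0), (n 0 1), (n 1 0); split; first by rewrite -E -mx2_eta.
    by apply/eqP; rewrite -oppr_eq0; apply/eqP; rewrite -[RHS]D E; ring.
  apply: contraNT N; rewrite negb_or !negbK => /andP[/eqP b0 /eqP c0].
  move: D; rewrite E b0 c0 mul0r subr0 mulrN => /eqP.
  by rewrite oppr_eq0 mulf_eq0 orbb => /eqP ->; rewrite oppr0 eqxx.
rewrite !mxE /= subrr eqxx; split => //.
  by rewrite -oppr_eq0; apply/eqP; rewrite -[RHS]E; ring.
by case/orP: N => /negPf ->; rewrite ?andbF.
Qed.

(** Here det(1 + n) = 1 + tr n + det n and tr(1 + n) = 2 + tr n. *)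
Lemma one_add_nilmx n : (1%:M + n \in SL2 F) && (\tr (1%:M + n) == 2) && (n != 0) = (n \in nilmx).
Proof.
rewrite !inE (mx2_eta n) scalar_mx2 addmx2 !mxtrace_mx2 !det_mx2.
move: (n 0 0) (n 0 1) (n 1 0) (n 1 1) => a b c d.
have -> : (1 + a + (1 + d) == 2) = (a + d == 0).
  by rewrite -subr_eq0; congr (_ == _); ring.
have -> : ((1 + a) * (1 + d) - (0 + b) * (0 + c) == 1) = (a + d + (a * d - b * c) == 0).
  by rewrite -subr_eq0; congr (_ == _); ring.
rewrite andbC andbCA andbA [RHS]andbA; case: (a + d =P 0) => [->|_].
  by rewrite add0r /= andbC.
by rewrite /= ?andbF.
Qed.

Hypothesis q3 : (#|F| %% 4 = 3)%N.

(** With q = 4k + 3, the sign is the quadratic character x^(2k+1); multiplied by [x] it gives the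
    square of x^(k+1). *)
Lemma sqrt_up_to_sign (x : F) :
  exists e y, [/\ e = 1 \/ e = -1 & e * x = y ^+ 2].
Proof.
case: (x =P 0) => [->|/eqP x0]; first by exists 1, 0; split; [left|ring].
pose k := (#|F| %/ 4)%N.
have qE : #|F| = (k * 4 + 3)%N by rewrite /k {1}(divn_eq #|F| 4) q3.
pose z := x ^+ (2 * k).+1.
have : z ^+ 2 == 1.
  rewrite -exprM; apply/eqP; apply: (mulIf x0).
  by rewrite -exprSr mul1r -[RHS]expf_card qE; congr (_ ^+ _); lia.
rewrite sqrf_eq1 => /orP H; exists z, (x ^+ k.+1); split.
  by case: H => /eqP; [left|right].
by rewrite /z -exprSr -exprM; congr (_ ^+ _); lia.
Qed.

(** A nonzero nilpotent is a scalar multiple of the column (u, v) times the row (v, -u). By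
    [sqrt_up_to_sign] the scalar reduces to a sign, which selects one of the two classes. *)
Lemma S_genE x : (x \in S_gen F) = (x - 1%:M \in nilmx).
Proof.
apply/idP/idP.
  have H e : (e != 0) -> x \in conjclass_SL2 (mx2 1 0 e 1) -> x - 1%:M \in nilmx.
    move=> e0 /imsetP[g /SL2_unit ug ->].
    have -> : g *m mx2 1 0 e 1 *m invmx g - 1%:M = g *m mx2 0 0 e 0 *m invmx g.
      have -> : mx2 1 0 e 1 = 1%:M + mx2 0 0 e 0.
        by rewrite scalar_mx2 addmx2 !(add0r, addr0).
      by rewrite mulmxDr mulmx1 mulmxDl mulmxV // addrC addKr.
    rewrite inE conj_mxtrace // conj_mxdet // mxtrace_mx2 det_mx2 addr0 !mul0r subr0 eqxx /=.
    apply: contra e0 => /eqP /(congr1 (fun A => invmx g *m A *m g)).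
    rewrite !mulmxA mulVmx // mul1mx -mulmxA mulVmx // mulmx1 mulmx0 mul0mx => /eqP.
    by rewrite mx2_eq0 => /and4P[].
  by rewrite inE => /orP[] /H; apply; rewrite ?oppr_eq0 oner_eq0.
move=> /nilmxP[a [b [c [E D N]]]].
suff [e [u [v [e1 [ea eb ec]]]]] : exists e u v, (e = 1 \/ e = -1) /\
   [/\ a = e * (u * v), b = - (e * u ^+ 2) & c = e * v ^+ 2].
  (* The nonzero vector (u, v) becomes the second column of a conjugating matrix of determinant
     1. *)
  have [g1 [g2 det_g]] : exists g1 g2, g1 * v - u * g2 = 1.
    case: (eqVneq v 0) => [v0|v0].
      have u0 : u != 0.
        by apply: contraTN N => /eqP u0; rewrite eb ec u0 v0 !(mulr0, expr2, oppr0) eqxx.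
      by exists 0, (- u^-1); rewrite mul0r sub0r mulrN opprK mulfV.
    by exists v^-1, 0; rewrite mulVf // mulr0 subr0.
  have gS : mx2 g1 u g2 v \in SL2 F by rewrite SL2E det_mx2 det_g.
  have xE : x = mx2 g1 u g2 v *m mx2 1 0 e 1 *m invmx (mx2 g1 u g2 v).
    rewrite invmx_SL2 // mxtrace_mx2 !scalar_mx2 oppmx2 addmx2 !mulmx2.
    rewrite -[x in LHS](subrK 1%:M) E scalar_mx2 addmx2 ea eb ec.
    by congr mx2; rewrite -?[in LHS]det_g; ring.
  rewrite inE; case: e1 xE {ea eb ec} => -> xE; apply/orP; [left|right];
  by apply/imsetP; exists (mx2 g1 u g2 v).
(* The sign is the square class of [c] if b = 0, and of [- b] otherwise. *)
case: (eqVneq b 0) => [b0|b0].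
  move: D N; rewrite b0 mul0r addr0 eqxx /= => /eqP; rewrite expf_eq0 /= => /eqP a0 c0.
  have [e [y [e1 cE]]] := sqrt_up_to_sign c; exists e, 0, y; split=> //.
  by split; rewrite -?cE ?a0; case: e1 => ->; ring.
have [e [y [e1 bE]]] := sqrt_up_to_sign (- b).
have ee : e * e = 1 by case: e1 => ->; ring.
have y0 : y != 0.
  apply: contra b0 => /eqP y0; rewrite y0 in bE.
  have : e * (e * - b) = 0 by rewrite bE; ring.
  by rewrite mulrA ee mul1r => /eqP; rewrite oppr_eq0.
exists e, y, (e * a / y); split=> //; split.
- by rewrite -[LHS]mul1r -ee; field.
- by rewrite -bE mulrA ee; ring.
- apply: (mulfI b0); have -> : b * c = - a ^+ 2 by rewrite -[LHS](addKr (a ^+ 2)) D addr0.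
  have -> : b = - (e * y ^+ 2) by rewrite -bE mulrA ee; ring.
  have -> : - (e * y ^+ 2) * (e * (e * a / y) ^+ 2) = - ((e * e) * (e * e) * a ^+ 2) by field.
  by rewrite ee; ring.
Qed.

End TwoByTwo.

(** * Counting nilpotents with a prescribed trace *)

Section Count.
Variable F : finFieldType.
Local Notation q := #|F|.
Local Notation nilmx := (nilmx F).

Lemma card_neq0 : #|[set x : F | x != 0]| = q.-1.
Proof. by rewrite -(cardC1 (0 : F)); apply: eq_card => x; rewrite !inE. Qed.

(** The equation a^2 + b c = 0 determines [c] if b is nonzero and forces a = 0 otherwise, so [f]
    identifies the nonzero nilpotents with the nonzero vectors of the plane. *)
Lemma card_nilmx : #|nilmx| = (q ^ 2).-1.
Proof.
pose f (n : 'M[F]_2) := (n 0 1, if n 0 1 == 0 then n 1 0 else n 0 0).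
have f_inj : {in nilmx &, injective f}.
  move=> _ _ /nilmxP[a [b [c [-> D _]]]] /nilmxP[a' [b' [c' [-> D' _]]]].
  rewrite /f !mxE /= => -[bb]; rewrite -bb in D' *.
  case: (eqVneq b 0) => [b0 cc|b0 aa].
    move: D D'; rewrite b0 cc !mul0r !addr0 => /eqP + /eqP.
    by rewrite !sqrf_eq0 => /eqP-> /eqP->.
  have cc: c = c' by apply: (mulfI b0); apply: (addrI (a ^+ 2)); rewrite D aa D'.
  by rewrite aa cc.
rewrite -(card_in_imset f_inj).
have -> : f @: nilmx = [set~ (0, 0)].
  apply/setP=> -[x y]; rewrite !inE; apply/imsetP/idP.
    case=> _ /nilmxP[a [b [c [-> D N]]]]; rewrite /f !mxE /= => -[-> ->].
    by apply/negP=> /eqP[b0]; move: N; rewrite b0 eqxx /= => /negP c0 /eqP.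
  rewrite xpair_eqE negb_and; case: (eqVneq x 0) => /= [-> y0|x0 _].
    exists (mx2 0 0 y 0); last by rewrite /f !mxE /= eqxx.
    by apply/nilmxP; exists 0, 0, y; rewrite oppr0 y0 orbT; split=> //; ring.
  exists (mx2 y x (- y ^+ 2 / x) (- y)); last by rewrite /f !mxE /= (negPf x0).
  apply/nilmxP; exists y, x, (- y ^+ 2 / x); split; rewrite ?x0 //.
  by field.
by rewrite cardsC1 card_prod mulnn.
Qed.

Lemma nilmxZ k n : k != 0 -> (k *: n \in nilmx) = (n \in nilmx).
Proof.
by move=> k0; rewrite !inE mxtraceZ detZ !mulf_eq0 scaler_eq0 (negPf k0).
Qed.

Lemma nilmxJ g n : g \in unitmx -> (g *m n *m invmx g \in nilmx) = (n \in nilmx).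
Proof.
move=> ug; rewrite !inE conj_mxtrace // conj_mxdet //; congr [&& _, _ & ~~ _].
apply/eqP/eqP => [|->]; last by rewrite mulmx0 mul0mx.
move=> /(congr1 (fun A => invmx g *m A *m g)).
by rewrite !mulmxA mulVmx // mul1mx -mulmxA mulVmx // mulmx1 mulmx0 mul0mx.
Qed.

Definition trcount (r : 'M[F]_2) (t : F) := #|[set n in nilmx | \tr (r *m n) == t]|.

Lemma trcountZ r k t : k != 0 -> trcount r (k * t) = trcount r t.
Proof.
move=> k0; rewrite /trcount -[RHS](card_imset _ (scalerI k0)).
apply: eq_card => n; apply/idP/imsetP => [|[m + ->]].
  rewrite inE => /andP[nN /eqP E]; exists (k^-1 *: n); last by rewrite scalerA mulfV ?scale1r.
  by rewrite inE nilmxZ ?invr_eq0 // nN -scalemxAr mxtraceZ E mulKf /=.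
move=> /setIdP[mN /eqP <-]; apply/setIdP.
by rewrite nilmxZ // -scalemxAr mxtraceZ.
Qed.

(* Scaling [n] permutes the nonzero values of the trace, so they are equidistributed. *)
Lemma trcount_total r t : t != 0 ->
  (trcount r 0%R + q.-1 * trcount r t)%N = (q ^ 2).-1.
Proof.
move=> t0; rewrite -card_nilmx.
have -> : #|nilmx| = (\sum_(u : F) trcount r u)%N.
  rewrite -sum1_card (partition_big (fun n => \tr (r *m n)) predT) //=.
  by apply: eq_bigr => u _; rewrite /trcount -sum1_card; apply: eq_bigl => n; rewrite inE.
rewrite (bigD1 0) //=; congr addn.
rewrite (eq_bigr (fun=> trcount r t)) => [|u u0].
  by rewrite sum_nat_const -(cardC1 (0 : F)).
by rewrite -[u in LHS](divfK t0) trcountZ // mulf_neq0 ?invr_eq0.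
Qed.

Lemma trcountJ r g t : g \in unitmx -> trcount (g *m r *m invmx g) t = trcount r t.
Proof.
move=> ug; have cI : injective (fun n => g *m n *m invmx g).
  apply: (can_inj (g := fun n => invmx g *m n *m g)) => n.
  by rewrite !mulmxA mulVmx // mul1mx -mulmxA mulVmx // mulmx1.
rewrite /trcount -[RHS](card_imset _ cI); apply: eq_card => n.
apply/idP/imsetP => [|[m + ->]].
  rewrite inE => /andP[nN /eqP E].
  have nE : n = g *m (invmx g *m n *m g) *m invmx g.
    by rewrite !mulmxA mulmxV // mul1mx -mulmxA mulmxV // mulmx1.
  exists (invmx g *m n *m g) => //; rewrite inE -(nilmxJ _ ug) -nE nN /=.
  by rewrite -E !mulmxA mxtrace_mulC !mulmxA.
move=> /setIdP[mN /eqP <-]; apply/setIdP; rewrite nilmxJ //; split=> //; apply/eqP.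
by rewrite !mulmxA mulmxKV // -(mulmxA g r) conj_mxtrace.
Qed.

(** If a = 0, the lower left entry of [n] must vanish and the upper right one is any nonzero scalar.
    Otherwise the lower left entry is any nonzero scalar and determines the rest: were it zero, the
    diagonal entry would be -1, with square 0. *)
Lemma trcount_rank1_row (a b : F) : (a != 0) || (b != 0) ->
  trcount (mx2 a b 0 0) (- a) = q.-1.
Proof.
move=> ab; rewrite -card_neq0 /trcount.
pose f x := if a == 0 then mx2 0 x 0 0 else
  mx2 (- 1 - b * x / a) (- (1 + b * x / a) ^+ 2 / x) x (1 + b * x / a).
have f_inj : injective f.
  by move=> x y; rewrite /f; case: ifP => _ /mx2_inj[].
rewrite -(card_imset _ f_inj); apply: eq_card => n; rewrite inE.
apply/andP/imsetP => [[/nilmxP[u [v [w [-> D N]]]]]|[x + ->]].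
  rewrite mulmx2 mxtrace_mx2 !mul0r !addr0 => /eqP T; rewrite /f.
  case: (eqVneq a 0) ab T => [-> /= b0|a0 _ T].
    rewrite mul0r add0r oppr0 => /eqP; rewrite mulf_eq0 (negPf b0) /= => /eqP w0.
    move: D N; rewrite w0 mulr0 addr0 eqxx orbF => /eqP; rewrite expf_eq0 /= => /eqP u0 v0.
    by exists v; rewrite ?inE // u0 oppr0.
  have uE : u = - 1 - b * w / a.
    by apply: (mulfI a0); apply: (addIr (b * w)); rewrite T; field.
  have w0 : w != 0.
    apply: contra_eqN D => /eqP w0; rewrite uE w0 !mulr0 mul0r subr0 addr0 sqrrN expr1n.
    exact: oner_neq0.
  exists w; rewrite ?inE //; congr mx2; rewrite ?uE //; last by ring.
  apply: (mulIf w0); apply: (addrI (u ^+ 2)); rewrite D uE; field.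
  by rewrite w0 a0.
rewrite inE /f; case: (eqVneq a 0) => [a0|a0] x0; split.
- by apply/nilmxP; exists 0, x, 0; rewrite x0 oppr0; split=> //; ring.
- by rewrite mulmx2 mxtrace_mx2 a0; apply/eqP; ring.
- apply/nilmxP; exists (- 1 - b * x / a), (- (1 + b * x / a) ^+ 2 / x), x.
  split; rewrite ?x0 ?orbT //; first by congr mx2; ring.
  by field; rewrite x0 a0.
- by rewrite mulmx2 mxtrace_mx2; apply/eqP; field; rewrite a0 x0.
Qed.

(** Conjugation, under which the count is invariant, makes the second row of [r] vanish. The value
    [- \tr r] expresses tr(r (1 + n)) = 0. *)
Lemma trcount_rank1 r : r != 0 -> \det r = 0 -> trcount r (- \tr r) = q.-1.
Proof.
rewrite (mx2_eta r); move: (r 0 0) (r 0 1) (r 1 0) (r 1 1) => a b c d.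
case: (boolP ((c == 0) && (d == 0))) => [/andP[/eqP-> /eqP->]|].
  rewrite mx2_eq0 eqxx !andbT negb_and mxtrace_mx2 addr0 => ab _.
  exact: trcount_rank1_row.
rewrite negb_and => cd _; rewrite det_mx2 => /eqP; rewrite subr_eq0 => /eqP D.
have [k [ka kb]] : exists k, a = k * c /\ b = k * d.
  case/orP: cd => z; [exists (a / c)|exists (b / d)]; split; apply: (mulIf z).
  - by field.
  - by rewrite -D; field.
  - by rewrite D; field.
  - by field.
(* As [r] is the column (k, 1) times the row (c, d), this matrix clears the second row: it sends
   that column to (-1, 0). *)
have gS : mx2 0 (-1) 1 (- k) \in SL2 F by rewrite SL2E det_mx2; apply/eqP; ring.
rewrite -(trcountJ _ _ (SL2_unit gS)) -(conj_mxtrace _ (SL2_unit gS)).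
have -> : mx2 0 (-1) 1 (- k) *m mx2 a b c d *m invmx (mx2 0 (-1) 1 (- k)) =
          mx2 (k * c + d) (- c) 0 0.
  rewrite invmx_SL2 // mxtrace_mx2 scalar_mx2 oppmx2 addmx2 !mulmx2 ka kb.
  by congr mx2; ring.
rewrite mxtrace_mx2 addr0; apply: trcount_rank1_row.
rewrite oppr_eq0; case: (eqVneq c 0) cd => [->|_ _]; last by rewrite orbT.
by rewrite mulr0 add0r orbF.
Qed.

End Count.

(** * Convolution identities in the group algebra *)

Section Convolution.
Variable F : finFieldType.
Local Notation q := #|F|.
Local Notation k := (q ^ 2).-1.
Local Notation SL2 := (SL2 F).
Implicit Types (x y g h s t : 'M[F]_2).

(** This is S when q = 3 mod 4, by [S_genE]. *)
Definition unip : {set 'M[F]_2} := [set x | x - 1%:M \in nilmx F].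

Lemma unipE x : (x \in unip) = [&& x \in SL2, \tr x == 2 & x != 1%:M].
Proof.
rewrite inE -one_add_nilmx addrC subrK subr_eq0.
by rewrite andbA.
Qed.

Lemma unip_SL2 x : x \in unip -> x \in SL2.
Proof. by rewrite unipE => /andP[]. Qed.

Lemma card_unip : #|unip| = k.
Proof.
rewrite -card_nilmx -[RHS](card_imset _ (addrI (1%:M : 'M[F]_2))); apply: eq_card => x.
apply/idP/imsetP => [|[n nN ->]]; rewrite inE; last by rewrite addrC addKr.
by move=> xN; exists (x - 1%:M); rewrite // addrC subrK.
Qed.

Lemma mxtraceV x : x \in SL2 -> \tr (invmx x) = \tr x.
Proof. by move=> xS; rewrite invmx_SL2 // raddfB /= mxtrace_scalar mulr2n addrK. Qed.

Lemma unipV x : (invmx x \in unip) = (x \in unip).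
Proof.
have V y : y \in unip -> invmx y \in unip.
  rewrite !unipE => /and3P[yS y2 y1]; rewrite SL2V // mxtraceV // y2 /=.
  by rewrite -(inj_eq (can_inj (@invmxK _ _))) invmxK invmx1.
by apply/idP/idP => /V; rewrite ?invmxK.
Qed.

Lemma unipJ g x : g \in unitmx -> (g *m x *m invmx g \in unip) = (x \in unip).
Proof.
by move=> ug; rewrite [LHS]inE [RHS]inE -(nilmxJ (x - 1%:M) ug) mulmxBr mulmx1 mulmxBl mulmxV.
Qed.

Lemma unipC x y : x \in unitmx -> (x *m y \in unip) = (y *m x \in unip).
Proof. by move=> ux; rewrite -(unipJ (y *m x) ux) mulmxA mulmxK. Qed.

(** The coefficient of [g] in S^2. *)
Definition unip_factorizations g :=
  #|[set s in unip | invmx s *m g \in unip]|.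

(** For s = 1 + n the inverse is 1 - n, so the trace of [invmx s *m g] is tr g - tr(g n), which has
    to be 2. *)
Lemma unip_factorizationsE g : g \in SL2 ->
  unip_factorizations g =
  #|[set n in nilmx F | (\tr (g *m n) == \tr g - 2) && (g != 1%:M + n)]|.
Proof.
move=> gS; rewrite /unip_factorizations -[RHS](card_imset _ (addrI (1%:M : 'M[F]_2))).
have key n : n \in nilmx F -> (1%:M + n \in unip) /\ (invmx (1%:M + n) *m g \in unip) =
    (\tr (g *m n) == \tr g - 2) && (g != 1%:M + n).
  move=> nN; have sU : 1%:M + n \in unip by rewrite inE addrC addKr.
  split=> //; have sS := unip_SL2 sU.
  rewrite unipE SL2M ?SL2V //=; congr (_ && ~~ _).
    rewrite invmx_SL2 //; move: sU; rewrite unipE => /and3P[_ /eqP-> _].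
    have -> : 2%:M - (1%:M + n) = 1%:M - n by rewrite opprD addrA -raddfB /= addrK.
    rewrite mulmxBl mul1mx raddfB /= [\tr (g *m n)]mxtrace_mulC.
    by rewrite -subr_eq0 -[RHS]subr_eq0 -[RHS]oppr_eq0; congr (_ == _); ring.
  by rewrite -(inj_eq (can_inj (mulKmx (SL2_unit sS)))) mulmxA mulmxV ?SL2_unit // mul1mx mulmx1.
apply: eq_card => s; apply/setIdP/imsetP => [[sU sgU]|[n /setIdP[nN nP] ->]].
  have nN : s - 1%:M \in nilmx F by rewrite inE in sU.
  exists (s - 1%:M); last by rewrite addrC subrK.
  by apply/setIdP; split=> //; rewrite -(key _ nN).2 addrC subrK.
by rewrite (key n nN).2; split=> //; case: (key n nN).
Qed.

Lemma trcount_nilmx n : n \in nilmx F -> trcount n 0 = q.-1.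
Proof.
rewrite inE => /and3P[/eqP t0 /eqP d0 n0].
by rewrite -(trcount_rank1 n0 d0) t0 oppr0.
Qed.

(* [S^2 + 2 S - k = q \sum_g g - St], multiplied by [q - 1]: [trcount g 0] counts
   the nilpotents whose kernel is a line fixed by [g], i.e. [(q - 1) (St g + 1)]. *)
Lemma unip_factorizations_trcount g : g \in SL2 ->
  (q.-1 * (unip_factorizations g + 2 * (g \in unip)) + trcount g 0%R =
   k + q.-1 * k * (g == 1%:M))%N.
Proof.
move=> gS; rewrite unip_factorizationsE // unipE gS /=.
(* If the trace is not 2, [g] is never 1 + n and the factorizations correspond to the nonzero trace
   value tr g - 2, so [trcount_total] applies. *)
case: (eqVneq (\tr g) 2) => [t2|t2] /=; last first.
  rewrite muln0 addn0; have -> : (g == 1%:M) = false.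
    by apply: contraNF t2 => /eqP ->; rewrite mxtrace_scalar.
  rewrite muln0 addn0 -(trcount_total g (t := \tr g - 2)) ?subr_eq0 // addnC.
  congr (_ + _ * _)%N; apply: eq_card => n; rewrite [LHS]inE [RHS]inE.
  case nN: (n \in nilmx F) => //=; case: eqP => //= _.
  apply: contraNneq t2 => ->; move: nN; rewrite inE => /andP[/eqP n0 _].
  by rewrite raddfD /= n0 mxtrace_scalar addr0.
rewrite t2 subrr; case: (eqVneq g 1%:M) => [->|g1] /=.
  have nE : [set n in nilmx F | (\tr (1%:M *m n) == 0) && (1%:M != 1%:M + n)] = nilmx F.
    apply/setP=> n; rewrite !inE mul1mx; case: (\tr n == 0) => //=.
    have -> : (1%:M == 1%:M + n) = (n == 0) by rewrite eq_sym addrC -subr_eq0 addrK.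
    by case: (n == 0); rewrite ?andbF ?andbT.
  have tE : trcount (1%:M : 'M[F]_2) 0 = #|nilmx F|.
    by apply: eq_card => n; rewrite !inE mul1mx; case: (\tr n == 0); rewrite ?andbF ?andbT.
  by rewrite nE tE card_nilmx muln0 addn0 muln1 addnC.
have mN : g - 1%:M \in nilmx F.
  have : g \in unip by rewrite unipE gS t2 eqxx g1.
  by rewrite inE.
have trE n : n \in nilmx F -> \tr (g *m n) = \tr ((g - 1%:M) *m n).
  by rewrite inE => /andP[/eqP t0 _]; rewrite mulmxBl mul1mx raddfB /= t0 subr0.
have tE : trcount g 0 = q.-1.
  rewrite -(trcount_nilmx mN); apply: eq_card => n; rewrite [LHS]inE [RHS]inE.
  by case nN: (n \in nilmx F) => //=; rewrite trE.
(* Among the q - 1 nilpotents with tr(g n) = 0, only n = g - 1 is excluded; it is one of them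
   because its square is 0. *)
have nE : #|[set n in nilmx F | (\tr (g *m n) == 0) && (g != 1%:M + n)]|.+1 = q.-1.
  rewrite -tE /trcount [RHS](cardsD1 (g - 1%:M)).
  have -> : g - 1%:M \in [set n in nilmx F | \tr (g *m n) == 0].
    apply/setIdP; split=> //; rewrite trE //; move: mN.
    rewrite -(mul0r (\tr (g - 1%:M))) inE => /andP[/eqP t0 /andP[/eqP d0 _]].
    have -> : (g - 1%:M) *m (g - 1%:M) = 0.
      move: t0 d0; rewrite (mx2_eta (g - 1%:M)).
      move: ((g - 1%:M) 0 0) ((g - 1%:M) 0 1) ((g - 1%:M) 1 0) ((g - 1%:M) 1 1) => a b c d.
      rewrite mxtrace_mx2 det_mx2 mulmx2 mx2_0 => /eqP; rewrite addrC addr_eq0 => /eqP ->.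
      by move=> E; congr mx2; first [ring | rewrite -[RHS]oppr0 -E; ring].
    by rewrite raddf0 mul0r.
  rewrite add1n; congr _.+1; apply: eq_card => n; rewrite !inE.
  rewrite [in LHS](addrC 1%:M) -subr_eq [n == g - _]eq_sym.
  by case: (_ == n); rewrite ?andbF ?andbT.
have q1 := finNzRing_gt1 F.
rewrite tE muln0 addn0 muln1; move: nE; set c := #|_| => nE.
have -> : (c + 2 = q)%N by lia.
by rewrite -mulnn; case: q => [//|n] /=; nia.
Qed.

(* [S St = 0], in the form [S (St + \sum_g g) = k \sum_g g], multiplied by [q - 1]. *)
Lemma sum_trcount_translates h : h \in SL2 ->
  (\sum_(s in unip) trcount (invmx s *m h) 0%R = k * q.-1)%N.
Proof.
move=> hS.
(* Inverting [s] and exchanging the sums leaves, for each [n], the number of [s] with tr(s h n) =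
   0. *)
rewrite (reindex_inj (can_inj (@invmxK F 2))) /=.
rewrite (eq_bigl _ _ unipV).
rewrite (eq_bigr (fun s => (\sum_(n in nilmx F) (\tr (s *m h *m n) == 0%R))%N)); last first.
  move=> s sU; rewrite invmxK /trcount -sum1_card big_mkcond [RHS]big_mkcond.
  by apply: eq_bigr => n _; rewrite inE; case: (n \in _); case: (_ == _).
rewrite exchange_big /= (eq_bigr (fun=> q.-1)) => [|n nN].
  by rewrite sum_nat_const card_nilmx.
have [hn0 hnd] : h *m n != 0 /\ \det (h *m n) = 0.
  move: nN; rewrite inE => /and3P[_ /eqP d0 n0]; split; last by rewrite det_mulmx d0 mulr0.
  apply: contra n0 => /eqP /(congr1 (mulmx (invmx h))).
  by rewrite mulKmx ?SL2_unit // mulmx0 => ->.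
(* For s = 1 + m the condition reads tr(h n m) = - tr(h n), the value counted by [trcount_rank1]. *)
rewrite -(trcount_rank1 hn0 hnd) /trcount.
rewrite -[RHS](card_imset _ (addrI (1%:M : 'M[F]_2))) -sum1_card big_mkcond [RHS]big_mkcond.
apply: eq_bigr => s _.
have -> : (s \in [set 1%:M + m | m in [set m in nilmx F | \tr (h *m n *m m) == - \tr (h *m n)]])
          = (s \in unip) && (\tr (s *m h *m n) == 0).
  apply/imsetP/andP => [[m /setIdP[mN /eqP mE] ->]|[sU /eqP sE]].
    rewrite inE addrC addKr mN; split=> //.
    by rewrite -mulmxA mulmxDl mul1mx raddfD /= [\tr (m *m _)]mxtrace_mulC mE subrr.
  exists (s - 1%:M); last by rewrite addrC subrK.
  rewrite inE in sU; apply/setIdP; split=> //.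
  by rewrite mulmxBr mulmx1 raddfB /= mxtrace_mulC mulmxA sE sub0r.
by case: (s \in unip) => //=; case: (_ == _).
Qed.

End Convolution.

(** * The Cayley operator and its spectrum *)

Section Spectrum.
Variable F : finFieldType.
Local Notation q := #|F|.
Local Notation k := (q ^ 2).-1.
Local Notation SL2 := (SL2 F).
Local Notation unip := (unip F).
Implicit Types (x y g h s t : 'M[F]_2) (f : 'M[F]_2 -> algC).

(** The operator T. Functions live on all matrices, but at points of [SL2] only their values on
    [SL2] enter. *)
Definition cayley_op f x : algC := \sum_(s in unip) f (x *m s).

Lemma reindex_SL2l x (H : 'M[F]_2 -> algC) : x \in SL2 ->
  \sum_(g in SL2) H (x *m g) = \sum_(g in SL2) H g.
Proof.
move=> xS; rewrite [RHS](reindex_inj (can_inj (mulKmx (SL2_unit xS)))) /=.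
apply: eq_bigl => g; apply/idP/idP => [|xgS]; first exact: SL2M.
by rewrite -(mulKmx (SL2_unit xS) g) SL2M ?SL2V.
Qed.

Lemma reindex_SL2r x (H : 'M[F]_2 -> algC) : x \in SL2 ->
  \sum_(g in SL2) H (g *m x) = \sum_(g in SL2) H g.
Proof.
move=> xS; rewrite [RHS](reindex_inj (can_inj (mulmxK (SL2_unit xS)))) /=.
apply: eq_bigl => g; apply/idP/idP => [gS|xgS]; first exact: SL2M.
by rewrite -(mulmxK (SL2_unit xS) g) SL2M ?SL2V.
Qed.

Lemma sum_cayley_op f : \sum_(x in SL2) cayley_op f x = k%:R * \sum_(x in SL2) f x.
Proof.
rewrite exchange_big /= (eq_bigr (fun=> \sum_(x in SL2) f x)).
  by rewrite sumr_const card_unip mulr_natl.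
by move=> s /unip_SL2 sS; rewrite reindex_SL2r.
Qed.

(** Composing operators convolves their kernels. *)
Lemma sum_unip_translate (c : 'M[F]_2 -> nat) f x : x \in SL2 ->
  \sum_(s in unip) \sum_(g in SL2) (c g)%:R * f (x *m s *m g) =
  \sum_(g in SL2) (\sum_(s in unip) c (invmx s *m g)%R)%:R * f (x *m g).
Proof.
move=> xS; rewrite (eq_bigr (fun s => \sum_(g in SL2) (c (invmx s *m g))%:R * f (x *m g))).
  rewrite exchange_big /=; apply: eq_bigr => g _.
  by rewrite natr_sum mulr_suml.
move=> s /unip_SL2 sS.
rewrite -(reindex_SL2l (fun g => (c (invmx s *m g))%:R * f (x *m g)) sS).
by apply: eq_bigr => g _; rewrite mulKmx ?SL2_unit // mulmxA.
Qed.

Lemma cayley_opE f x : cayley_op f x = \sum_(g in SL2) (g \in unip)%:R * f (x *m g).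
Proof.
rewrite /cayley_op big_mkcond [RHS]big_mkcond; apply: eq_bigr => g _.
case: (boolP (g \in unip)) => [/unip_SL2 -> | _]; rewrite ?mul1r //.
by rewrite mul0r if_same.
Qed.

Lemma cayley_op2 f x : x \in SL2 ->
  cayley_op (cayley_op f) x =
  \sum_(g in SL2) (unip_factorizations g)%:R * f (x *m g).
Proof.
move=> xS; rewrite {1}/cayley_op (eq_bigr _ (fun s _ => cayley_opE f (x *m s))).
rewrite (sum_unip_translate (fun g => g \in unip)) //.
apply: eq_bigr => g _; congr (_%:R * _); rewrite /unip_factorizations -sum1_card.
rewrite big_mkcond [RHS]big_mkcond; apply: eq_bigr => s _; rewrite inE.
by case: (s \in unip); case: (_ \in unip).
Qed.

(** The identity [unip_factorizations_trcount] is summed against [f]; its constant term contributes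
    a multiple of the sum of [f], hence 0. *)
Lemma cayley_op_quadratic f x : x \in SL2 -> \sum_(g in SL2) f g = 0 ->
  q.-1%:R * (cayley_op (cayley_op f) x + 2 * cayley_op f x - k%:R * f x) =
  - \sum_(g in SL2) (trcount g 0)%:R * f (x *m g).
Proof.
move=> xS f0; apply/eqP; rewrite -subr_eq0 opprK.
rewrite cayley_op2 // cayley_opE.
have fxE : f x = \sum_(g in SL2) (g == 1%:M)%:R * f (x *m g).
  rewrite (bigD1 1%:M) ?SL2_1 //= eqxx mul1r mulmx1 big1 ?addr0 // => g /andP[_ /negPf ->].
  by rewrite mul0r.
apply/eqP; rewrite fxE !mulr_sumr -big_split /= -sumrB mulr_sumr -big_split /=.
rewrite (eq_bigr (fun g => k%:R * f (x *m g))) => [|g gS].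
  by rewrite -mulr_sumr reindex_SL2l // f0 mulr0.
have := congr1 (fun n => n%:R : algC) (unip_factorizations_trcount gS).
by rewrite !(natrD, natrM) => /(canRL (addKr _)) ->; ring.
Qed.

(** By [sum_trcount_translates] the composed kernel is constant, so it annihilates functions of sum
    zero. *)
Lemma cayley_op_trcount f x : x \in SL2 -> \sum_(g in SL2) f g = 0 ->
  cayley_op (fun y => \sum_(g in SL2) (trcount g 0)%:R * f (y *m g)) x = 0.
Proof.
move=> xS f0; rewrite /cayley_op (sum_unip_translate (fun g => trcount g 0)) //.
rewrite (eq_bigr (fun g => (k * q.-1)%:R * f (x *m g))) => [|g gS].
  by rewrite -mulr_sumr reindex_SL2l // f0 mulr0.
by rewrite sum_trcount_translates.
Qed.

Lemma cayley_op_cubic f x : x \in SL2 -> \sum_(g in SL2) f g = 0 ->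
  cayley_op (cayley_op (cayley_op f)) x + 2 * cayley_op (cayley_op f) x
  - k%:R * cayley_op f x = 0.
Proof.
move=> xS f0; have q1 : q.-1%:R != 0 :> algC.
  by rewrite pnatr_eq0 -lt0n -ltnS prednK ?finNzRing_gt1 // ltnW ?finNzRing_gt1.
apply: (mulfI q1); rewrite mulr0 -[RHS]oppr0 -(cayley_op_trcount xS f0).
rewrite {1 3 5 6}/cayley_op 2!mulr_sumr -big_split /= -sumrB mulr_sumr -sumrN.
by apply: eq_bigr => s /unip_SL2 sS; rewrite -cayley_op_quadratic // SL2M.
Qed.

(** An eigenfunction of T^2 need not be one of T, so T f is eliminated: the cubic relation gives (m
    - k) T f = - 2 m f, and applying T gives (m - k) m f = - 2 m T f. *)
Lemma cayley_op2_eigenvalue f x (m : algC) : x \in SL2 -> f x != 0 ->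
  {in SL2, forall y, cayley_op (cayley_op f) y = m * f y} ->
  [\/ m = k%:R ^+ 2, m = 0 | (m - k%:R) ^+ 2 = 4 * m].
Proof.
move=> xS fx eig.
(* T multiplies sums over the group by k, so m = k^2 or [f] has sum zero. *)
have : (k%:R ^+ 2 - m) * \sum_(y in SL2) f y = 0.
  rewrite mulrBl expr2 -mulrA -!sum_cayley_op mulr_sumr -(eq_bigr _ eig).
  exact: subrr.
move/eqP; rewrite mulf_eq0 subr_eq0 => /orP[/eqP <-|/eqP f0]; first by constructor 1.
have lin y : y \in SL2 -> (m - k%:R) * cayley_op f y = - 2 * m * f y.
  move=> yS; apply/eqP; rewrite -subr_eq0; apply/eqP.
  have eig3 : cayley_op (cayley_op (cayley_op f)) y = m * cayley_op f y.
    rewrite [cayley_op f y in RHS]/cayley_op mulr_sumr.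
    by apply: eq_bigr => s /unip_SL2 sS; rewrite eig ?SL2M.
  by rewrite -[RHS](cayley_op_cubic yS f0) eig3 eig //; ring.
have quad : (m - k%:R) * (m * f x) = - 2 * m * cayley_op f x.
  rewrite -eig // /cayley_op !mulr_sumr; apply: eq_bigr => s /unip_SL2 sS.
  by rewrite -lin ?SL2M.
have : m * ((m - k%:R) ^+ 2 - 4 * m) = 0.
  apply: (mulIf fx); rewrite mul0r.
  have -> : m * ((m - k%:R) ^+ 2 - 4 * m) * f x =
     (m - k%:R) * ((m - k%:R) * (m * f x)) - 4 * m ^+ 2 * f x by ring.
  rewrite quad.
  have -> : (m - k%:R) * (- 2 * m * cayley_op f x) =
     - 2 * m * ((m - k%:R) * cayley_op f x) by ring.
  by rewrite lin //; ring.
move/eqP; rewrite mulf_eq0 subr_eq0 => /orP[] /eqP; first by constructor 2.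
by constructor 3.
Qed.

Lemma ramanujan_bound (l : algC) : (2 < q)%N ->
  [\/ l ^+ 2 = k%:R ^+ 2, l ^+ 2 = 0 | (l ^+ 2 - k%:R) ^+ 2 = 4 * l ^+ 2] ->
  `|l| != k%:R -> `|l| <= 2 * sqrtC (k.-1)%:R.
Proof.
move=> q3 H lk.
(* Squared, this is (q + 1)^2 <= 4 (q^2 - 2), true from q = 3 on. *)
have bnd : q.+1%:R <= 2 * sqrtC k.-1%:R :> algC.
  rewrite -(ler_pXn2r (n := 2)) ?nnegrE ?ler0n ?mulr_ge0 ?sqrtC_ge0 ?ler0n //.
  rewrite exprMn sqrtCK -!natrX -natrM ler_nat -!mulnn.
  case: q q3 => [|[|[|n]]] // _; rewrite -subn1 /=; nia.
case: H => [/eqP|/eqP|E].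
- rewrite eqf_sqr => /orP[] /eqP lE; move: lk.
    by rewrite lE normr_nat eqxx.
  by rewrite lE normrN normr_nat eqxx.
- by rewrite expf_eq0 /= => /eqP ->; rewrite normr0 mulr_ge0 ?sqrtC_ge0 ?ler0n.
apply: le_trans bnd; have kE : k%:R = q%:R ^+ 2 - 1 :> algC.
  have q0 : (0 < q ^ 2)%N by rewrite expn_gt0 (ltn_trans _ q3).
  by rewrite -natrX -{2}(prednK q0) -[in RHS]natr1 addrK.
(* With k = q^2 - 1 the quartic equation in [l] splits into these two factors. *)
have : ((l - 1) ^+ 2 - q%:R ^+ 2) * ((l + 1) ^+ 2 - q%:R ^+ 2) = 0.
  have -> : ((l - 1) ^+ 2 - q%:R ^+ 2) * ((l + 1) ^+ 2 - q%:R ^+ 2) =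
    (l ^+ 2 - (q%:R ^+ 2 - 1)) ^+ 2 - 4 * l ^+ 2 by ring.
  by rewrite -kE E subrr.
have tri (a b : algC) : `|a| <= q%:R -> `|b| <= 1 -> `|a + b| <= q.+1%:R.
  by move=> Ha Hb; rewrite (le_trans (ler_normD _ _)) // -natr1 lerD.
have sqr (a : algC) : a ^+ 2 - q%:R ^+ 2 = 0 -> `|a| <= q%:R.
  by move/eqP; rewrite subr_eq0 eqf_sqr => /orP[] /eqP ->; rewrite ?normrN normr_nat.
move/eqP; rewrite mulf_eq0 => /orP[] /eqP /sqr /tri.
  by move/(_ 1); rewrite subrK normr1; apply.
by move/(_ (-1)); rewrite addrK normrN normr1; apply.
Qed.

End Spectrum.

(** * Adjacency matrices of the three graphs *)

Section Graphs.
Variable F : finFieldType.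
Local Notation q := #|F|.
Local Notation k := (q ^ 2).-1.
Local Notation SL2 := (SL2 F).
Local Notation unip := (unip F).
Implicit Types (x y g s t w : 'M[F]_2) (f : 'M[F]_2 -> algC).

Lemma adjmx_mulr (e : 'M[F]_2 -> 'M[F]_2 -> 'M[F]_2) f (i : 'I_#|SL2|) :
  {in SL2 & unip, forall x s, e x s \in SL2} ->
  \sum_j adjmx unip e i j * f (enum_val j) = \sum_(s in unip) f (e (enum_val i) s).
Proof.
move=> eS.
rewrite (eq_bigr (fun j => \sum_(s in unip) (e (enum_val i) s == enum_val j)%:R * f (enum_val j))).
  rewrite exchange_big; apply: eq_bigr => s sU /=.
  rewrite -(big_enum_val (fun y => (e (enum_val i) s == y)%:R * f y)) /=.
  rewrite (bigD1 (e (enum_val i) s)) /=; last by rewrite eS ?enum_valP.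
  rewrite eqxx mul1r big1 ?addr0 // => y /andP[_]; rewrite eq_sym => /negPf ->.
  by rewrite mul0r.
move=> j _; rewrite -mulr_suml mxE; congr (_ * _).
rewrite -sum1_card natr_sum big_mkcond [RHS]big_mkcond; apply: eq_bigr => s _.
by rewrite inE; case: (s \in unip); case: (_ == _).
Qed.

(** [c x y] is the only label that can lead from [x] to [y], so every entry is 0 or 1 and symmetry
    becomes a property of [c]. *)
Lemma adjmx_sym (e c : 'M[F]_2 -> 'M[F]_2 -> 'M[F]_2) :
  (forall x y s, x \in SL2 -> y \in SL2 -> (e x s == y) = (s == c x y)) ->
  {in SL2 &, forall x y, (c x y \in unip) = (c y x \in unip)} ->
  (adjmx unip e)^T = adjmx unip e.
Proof.
move=> ec cC.
have adjE (i j : 'I_#|SL2|) : adjmx unip e i j = (c (enum_val i) (enum_val j) \in unip)%:R.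
  rewrite mxE; congr _%:R; set y := c _ _.
  have -> : #|[set s in unip | e (enum_val i) s == enum_val j]| = #|unip :&: [set y]|.
    by apply: eq_card => s; rewrite in_setI in_set1 in_set ec ?enum_valP.
  case: (boolP (y \in unip)) => yU; first by rewrite (setIidPr _) ?cards1 ?sub1set.
  by apply/eqP; rewrite cards_eq0 setI_eq0 disjoint_sym disjoints1.
by apply/matrixP => i j; rewrite mxE !adjE cC ?enum_valP.
Qed.

(** An eigenvector for [l] yields an eigenfunction of T^2 for l^2, which suffices to bound [l]. *)
Lemma Ramanujan_of_square (e : 'M[F]_2 -> 'M[F]_2 -> 'M[F]_2) : (2 < q)%N ->
  {in SL2 & unip, forall x s, e x s \in SL2} ->
  (adjmx unip e)^T = adjmx unip e ->
  (forall f x, x \in SL2 ->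
    \sum_(s in unip) \sum_(t in unip) f (e (e x s) t) = cayley_op (cayley_op f) x) ->
  Ramanujan (adjmx unip e).
Proof.
move=> q3 eS sym sq; exists k; split=> // [i|l /eigenvalueP[v vA v0]].
  rewrite -(card_unip F) -sumr_const -(adjmx_mulr (fun=> 1) i eS).
  by apply: eq_bigr => j _; rewrite mulr1.
pose f y := \sum_i (enum_val i == y)%:R * v 0 i.
have fE i : f (enum_val i) = v 0 i.
  rewrite /f (bigD1 i) //= eqxx mul1r big1 ?addr0 // => j /negPf ji.
  by rewrite (inj_eq enum_val_inj) ji mul0r.
(* Eigenvectors are rows here; symmetry turns the sum over incoming edges into one over outgoing
   edges. *)
have eig x : x \in SL2 -> \sum_(s in unip) f (e x s) = l * f x.
  move=> xS; rewrite -(enum_rankK_in xS xS) -adjmx_mulr // fE.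
  have := congr1 (fun u : 'rV_ _ => u 0 (enum_rank_in xS x)) vA.
  rewrite [RHS]mxE => <-; rewrite [RHS]mxE; apply: eq_bigr => j _.
  by rewrite fE mulrC -[in LHS]sym mxE.
have [x xS fx] : exists2 x, x \in SL2 & f x != 0.
  have /rV0Pn[i vi] := v0.
  by exists (enum_val i); rewrite ?enum_valP ?fE.
have eig2 : {in SL2, forall y, cayley_op (cayley_op f) y = l ^+ 2 * f y}.
  move=> y yS; rewrite -sq // (eq_bigr (fun s => l * f (e y s))) => [|s sU].
    by rewrite -mulr_sumr eig // mulrA expr2.
  by rewrite eig ?eS.
exact/ramanujan_bound/(cayley_op2_eigenvalue xS fx eig2).
Qed.

Lemma invmx_mul x y : x \in unitmx -> y \in unitmx ->
  invmx (x *m y) = invmx y *m invmx x.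
Proof.
move=> ux uy; have uxy : x *m y \in unitmx by rewrite unitmx_mul ux.
apply: (can_inj (mulKmx uxy)).
by rewrite mulmxV // mulmxA mulmxK // mulmxV.
Qed.

(** This covers both the twists [conjby w] and the identity, which gives the untwisted graph. *)
Definition unip_involution (sg : 'M[F]_2 -> 'M[F]_2) :=
  [/\ {morph sg : x y / x *m y}, involutive sg,
      forall x, (sg x \in SL2) = (x \in SL2) &
      forall x, (sg x \in unip) = (x \in unip)].

Lemma unip_involutionV sg x : unip_involution sg -> x \in SL2 ->
  sg (invmx x) = invmx (sg x).
Proof.
move=> [sgM _ sgS _] xS.
have sg1 : sg 1%:M = 1%:M.
  have u1 : sg 1%:M \in unitmx by rewrite SL2_unit ?sgS ?SL2_1.
  by apply: (can_inj (mulKmx u1)); rewrite -sgM !mulmx1.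
have ux : sg x \in unitmx by rewrite SL2_unit ?sgS.
by apply: (can_inj (mulKmx ux)); rewrite -sgM [x *m _]mulmxV ?SL2_unit // sg1 mulmxV.
Qed.

Lemma sum_unip_involution sg f : unip_involution sg ->
  \sum_(t in unip) f (sg t) = \sum_(t in unip) f t.
Proof.
move=> [_ sgK _ sgU]; rewrite [RHS](reindex_inj (inv_inj sgK)) /=.
by apply: eq_bigl => t; rewrite sgU.
Qed.

(** Two steps lead from [x] to x s sg(t), and [sg] permutes S. *)
Lemma Ramanujan_twist sg : (2 < q)%N -> unip_involution sg ->
  Ramanujan (adjmx unip (fun x s => sg (x *m s))).
Proof.
move=> q3 sgP; have [sgM sgK sgS sgU] := sgP; apply: Ramanujan_of_square => //.
- by move=> x s xS /unip_SL2 sS; rewrite sgS SL2M.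
- apply: (adjmx_sym (c := fun x y => invmx x *m sg y)) => [x y s xS yS|x y xS yS].
    rewrite -(inj_eq (inv_inj sgK)) sgK.
    by rewrite -(inj_eq (can_inj (mulKmx (SL2_unit xS))) s) mulKVmx ?SL2_unit.
  rewrite -sgU sgM sgK unip_involutionV // -unipV.
  by rewrite invmx_mul ?SL2_unit ?SL2V ?sgS // invmxK.
- move=> f x xS; apply: eq_bigr => s _.
  rewrite -[RHS](sum_unip_involution (fun t => f (x *m s *m t)) sgP).
  by apply: eq_bigr => t _; rewrite sgM sgK.
Qed.

(** Two steps lead from [x] to s^-1 x sg(t) = x (x^-1 s^-1 x) sg(t); both [sg] and the map from s to
    x^-1 s^-1 x permute S. *)
Lemma Ramanujan_Sigma_twist sg : (2 < q)%N -> unip_involution sg ->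
  Ramanujan (adjmx unip (fun x s => sg (invmx x *m s))).
Proof.
move=> q3 sgP; have [sgM sgK sgS sgU] := sgP; apply: Ramanujan_of_square => //.
- by move=> x s xS /unip_SL2 sS; rewrite sgS SL2M ?SL2V.
- apply: (adjmx_sym (c := fun x y => x *m sg y)) => [x y s xS yS|x y xS yS].
    rewrite -(inj_eq (inv_inj sgK)) sgK.
    by rewrite -(inj_eq (can_inj (mulKmx (SL2_unit xS))) (invmx x *m s)) mulKVmx ?SL2_unit.
  by rewrite -sgU sgM sgK unipC ?SL2_unit ?sgS.
- move=> f x xS.
  have invP s : s \in SL2 -> sg (invmx (sg (invmx x *m s))) = invmx s *m x.
    move=> sS; rewrite unip_involutionV ?sgS ?SL2M ?SL2V // sgK.
    by rewrite invmx_mul ?SL2_unit ?SL2V // invmxK.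
  pose h s := invmx x *m invmx s *m x.
  have h_inj : injective h.
    move=> s t /(can_inj (mulmxK (SL2_unit xS))).
    by move=> /(can_inj (mulKmx (SL2_unit (SL2V xS)))) /(can_inj (@invmxK F 2)).
  have hU s : (h s \in unip) = (s \in unip).
    by rewrite /h -{2}(invmxK x) unipJ ?unitmx_inv ?SL2_unit // unipV.
  rewrite {1}/cayley_op [RHS](reindex_inj h_inj) /=.
  apply: eq_big => // s /unip_SL2 sS.
  rewrite -[RHS](sum_unip_involution (fun t => f (x *m h s *m t)) sgP).
  apply: eq_bigr => t _; rewrite sgM invP //; congr (f (_ *m _)).
  by rewrite /h -mulmxA mulKVmx ?SL2_unit.
Qed.

Lemma conjby_unip_involution w (c : F) : w \in unitmx -> w *m w = c%:M ->
  unip_involution (conjby w).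
Proof.
move=> uw ww; split=> [x y|x|x|x]; rewrite /conjby.
- by rewrite !mulmxA mulmxKV.
- by rewrite !mulmxA ww -scalar_mxC -ww !mulmxA !mulmxK.
- by rewrite !inE conj_mxdet.
- exact: unipJ.
Qed.

End Graphs.

Theorem theorem5p3 (F : finFieldType) (hq : (#|F| %% 4 = 3)%N)
  (w : 'M[F]_2) (hw : w = mx2 0 1 1 0 \/ w = mx2 0 1 (-1) 0) :
  [/\ Ramanujan (adjmx (S_gen F) (@edge_Sigma F)),
      Ramanujan (adjmx (S_gen F) (edge_twist w)) &
      Ramanujan (adjmx (S_gen F) (edge_Sigma_twist w))].
Proof.
have q3 : (2 < #|F|)%N by rewrite ltnNge; apply/negP=> q2; move: hq; rewrite modn_small; lia.
have -> : S_gen F = unip F by apply/setP => x; rewrite S_genE // [RHS]inE.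
have wP : unip_involution (conjby w).
  (* The squares of the two matrices are the scalars 1 and -1. *)
  case: hw => ->; [apply: (@conjby_unip_involution _ _ 1)|apply: (@conjby_unip_involution _ _ (-1))].
  - by rewrite unitmxE det_mx2 unitfE; rewrite mul0r mul1r sub0r oppr_eq0 oner_eq0.
  - by rewrite mulmx2 scalar_mx2; congr mx2; ring.
  - by rewrite unitmxE det_mx2 unitfE; rewrite mul0r mul1r sub0r opprK oner_eq0.
  - by rewrite mulmx2 scalar_mx2; congr mx2; ring.
split; [exact: (@Ramanujan_Sigma_twist _ id)|exact: Ramanujan_twist|exact: Ramanujan_Sigma_twist].
Qed.
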